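(* Let $\mathfrak{g}_\lambda$ be a generic oscillator Lie algebra. Then: 1. A bivector $r\in\wedge^2\mathfrak{g}_\lambda$ is a solution of the generalized Yang-Baxter equation if and only if there exist $u_0\in S$, $r_0\in\wedge^2S$ and $\alpha\in\mathbb{R}$ such that $r=2\alpha\, e_0\wedge e_{-1}+e_0\wedge u_0+r_0$ and $$\omega_{r_0,\mathrm{ad}_{e_{-1}}^\dagger r_0}+\alpha\,(\mathrm{ad}_{e_{-1}}^\dagger\circ\mathrm{ad}_{e_{-1}}^\dagger)r_0=0.$$ 2. A bivector $r\in\wedge^2\mathfrak{g}_\lambda$ is a solution of the classical Yang-Baxter equation if and only if there exist $u_0\in S$, $r_0\in\wedge^2S$ and $\alpha\in\mathbb{R}$ such that $r=\alpha\, e_0\wedge e_{-1}+e_0\wedge u_0+r_0$ and $$\omega_{r_0,r_0}+\alpha\,\mathrm{ad}_{e_{-1}}^\dagger r_0=0.$$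
   Context: Yang-Baxter equations: for a Lie algebra $\mathfrak{g}$ and $r\in\wedge^2\mathfrak{g}$, let $[r,r]\in\wedge^3\mathfrak{g}$ be the Schouten bracket, $[r,r](\alpha,\beta,\gamma)=2\alpha([r_\#(\beta),r_\#(\gamma)])+2\beta([r_\#(\gamma),r_\#(\alpha)])+2\gamma([r_\#(\alpha),r_\#(\beta)])$. The generalized (classical) Yang-Baxter equation is $\mathrm{ad}_u[r,r]=0$ for all $u\in\mathfrak{g}$; the classical Yang-Baxter equation is $[r,r]=0$. Oscillator Lie algebra: for $n\ge 1$ and $\lambda=(\lambda_1,\dots,\lambda_n)\in\mathbb{R}^n$ with $0<\lambda_1\le\dots\le\lambda_n$, $\mathfrak{g}_\lambda$ is the real Lie algebra with basis $e_{-1},e_0,e_i,\check e_i$ ($i=1,\dots,n$) and brackets $[e_{-1},e_j]=\lambda_j\check e_j$, $[e_{-1},\check e_j]=-\lambda_je_j$, $[e_j,\check e_j]=e_0$, the unspecified brackets being zero or given by antisymmetry. It is generic if $0<\lambda_1<\dots<\lambda_n$ and $\lambda_k\ne\lambda_i+\lambda_j$ for all $1\le i<j<k\le n$. Let $S=\mathrm{span}\{e_i,\check e_i\}_{i=1,\dots,n}$. Let $\omega$ be the 2-form on $\mathfrak{g}_\lambda$ with $\omega(e_{-1},\cdot)=\omega(e_0,\cdot)=0$, $\omega(e_i,e_j)=\omega(\check e_i,\check e_j)=0$, $\omega(e_i,\check e_j)=\delta_{ij}$. Let $e_{-1}^*,e_0^*,e_i^*,\check e_i^*$ be the dual basis.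 Elements $r\in\wedge^2\mathfrak{g}_\lambda$ are regarded as skew-symmetric bilinear forms on $\mathfrak{g}_\lambda^*$, with $(v\wedge w)(\alpha,\beta)=\alpha(v)\beta(w)-\alpha(w)\beta(v)$; $r_\#:\mathfrak{g}_\lambda^*\to\mathfrak{g}_\lambda$ is defined by $\beta(r_\#(\alpha))=r(\alpha,\beta)$. By $\wedge^2S$ is meant the space of $r\in\wedge^2\mathfrak{g}_\lambda$ with $r_\#(e_{-1}^* )=r_\#(e_0^* )=0$. For $r_1,r_2\in\wedge^2\mathfrak{g}_\lambda$, $$\omega_{r_1,r_2}(\alpha,\beta)=\tfrac12\big(\omega(r_{1\#}(\alpha),r_{2\#}(\beta))+\omega(r_{2\#}(\alpha),r_{1\#}(\beta))\big).$$ For $u\in\mathfrak{g}_\lambda$, $\mathrm{ad}_u^*\alpha=\alpha\circ\mathrm{ad}_u$ and $(\mathrm{ad}_u^\dagger r)(\alpha,\beta)=r(\mathrm{ad}_u^*\alpha,\beta)+r(\alpha,\mathrm{ad}_u^*\beta)$ (the adjoint action on $\wedge^2\mathfrak{g}_\lambda$). *)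

(* Defs.v *)
From HB Require Import structures.
From mathcomp Require Import all_boot all_order all_algebra.
From mathcomp Require Import ring.

Set Implicit Arguments.
Unset Strict Implicit.
Unset Printing Implicit Defensive.

Import Order.TTheory GRing.Theory Num.Theory.
Local Open Scope ring_scope.

HB.mixin Record Vector_isLie (K : fieldType) L & Vector K L := {
  lie : L -> L -> L;
  lie_linearl : forall v, linear (lie^~ v);
  lie_linearr : forall u, linear (lie u);
  liexx : forall u, lie u u = 0;
  lie_jacobi : forall u v w,
    lie u (lie v w) + lie v (lie w u) + lie w (lie u v) = 0
}.

#[short(type="lieAlgType")]
HB.structure Definition LieAlgebra (K : fieldType) :=
  { L of Vector K L & Vector_isLie K L }.

Definition dual (K : fieldType) (V : vectType K) := 'Hom(V, K^o).

Section Bivectors.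
Variables (K : fieldType) (g : lieAlgType K).
Implicit Types (r : dual g -> dual g -> K) (a b c : dual g) (u v w : g).

(* The elements of the exterior square of g, as skew-symmetric bilinear forms
   on the dual of g. *)
Definition bivector r : Prop :=
  bilinear_for *%R *%R r /\ (forall a b, r a b = - r b a).

Definition wedge v w : dual g -> dual g -> K :=
  fun a b => a v * b w - a w * b v.

Definition coord_form (i : 'I_(\dim (fullv : {vspace g}))) : dual g :=
  linfun (coord (vbasis fullv) i : g -> K^o).

(* r_#, characterised by b (r_# a) = r a b; see sharpP. *)
Definition sharp r a : g :=
  \sum_i r a (coord_form i) *: (vbasis (fullv : {vspace g}))`_i.

(* a \o ad_u *)
Definition coad u a : dual g := (a \o linfun (lie u))%VF.

(* The action ad_u^dagger on bivectors *)
Definition ad2 u r : dual g -> dual g -> K :=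
  fun a b => r (coad u a) b + r a (coad u b).

(* The same action on trivectors *)
Definition ad3 u (t : dual g -> dual g -> dual g -> K) :
    dual g -> dual g -> dual g -> K :=
  fun a b c => t (coad u a) b c + t a (coad u b) c + t a b (coad u c).

Definition schouten r : dual g -> dual g -> dual g -> K :=
  fun a b c =>
    2 * a (lie (sharp r b) (sharp r c))
  + 2 * b (lie (sharp r c) (sharp r a))
  + 2 * c (lie (sharp r a) (sharp r b)).

Definition generalized_yang_baxter r : Prop :=
  forall u a b c, ad3 u (schouten r) a b c = 0.

Definition classical_yang_baxter r : Prop :=
  forall a b c, schouten r a b c = 0.

(* The form omega_{r1, r2} on the dual attached to a 2-form om on g *)
Definition form2 (om : g -> g -> K) r1 r2 : dual g -> dual g -> K :=
  fun a b =>
    2^-1 * (om (sharp r1 a) (sharp r2 b) + om (sharp r2 a) (sharp r1 b)).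

Lemma coadE u a v : coad u a v = a (lie u v).
Proof.
pose m := GRing.isLinear.Build K g g *:%R (lie u) (lie_linearr u).
pose f : {linear g -> g} := HB.pack (lie u) m.
by rewrite /coad comp_lfunE (lfunE f).
Qed.

Lemma sharpP r : (forall a, linear (r a : dual g -> K^o)) ->
  forall a b, b (sharp r a) = r a b.
Proof.
move=> rlin a b.
pose m := GRing.isLinear.Build K (dual g) K^o *:%R (r a) (rlin a).
pose f : {linear dual g -> K^o} := HB.pack (r a : dual g -> K^o) m.
have -> : r a b = f b by [].
have -> : b = \sum_(i < \dim (fullv : {vspace g}))
      b (vbasis (fullv : {vspace g}))`_i *: coord_form i.
  apply/lfunP=> v; rewrite {1}(coord_vbasis (memvf v)) linear_sum sum_lfunE.
  apply: eq_bigr => i _.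
  by rewrite linearZ /= scale_lfunE lfunE /= /GRing.scale /= mulrC.
rewrite sum_lfunE [RHS]linear_sum; apply: eq_bigr => i _.
rewrite scale_lfunE [RHS]linearZ; congr (_ *: _).
have fb := basis_free (vbasisP (fullv : {vspace g})).
rewrite /sharp linear_sum /= (bigD1 i) //= big1 ?addr0 => [|j ji].
  by rewrite linearZ /= lfunE /= coord_free // eqxx /GRing.scale /= mulr1.
by rewrite linearZ /= lfunE /= coord_free // (negbTE ji) scaler0.
Qed.

End Bivectors.

(* The quadruple (a, b, x, y) stands for
   a e_{-1} + b e_0 + sum_i (x_i e_i + y_i ec_i). *)
Definition oscillator (K : fieldType) (n : nat) (lambda : 'I_n -> K) : Type :=
  (K^o * K^o * 'rV[K]_n * 'rV[K]_n)%type.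

Section Oscillator.
Variables (K : fieldType) (n : nat) (lambda : 'I_n -> K).
Local Notation g := (oscillator lambda).

HB.instance Definition _ := Vector.on g.

Definition cm1 (u : g) : K := u.1.1.1.
Definition c0 (u : g) : K := u.1.1.2.
Definition cx (i : 'I_n) (u : g) : K := u.1.2 0 i.
Definition cy (i : 'I_n) (u : g) : K := u.2 0 i.

Definition em1 : g := (1, 0, 0, 0).
Definition e0 : g := (0, 1, 0, 0).
Definition e (i : 'I_n) : g := (0, 0, delta_mx 0 i, 0).
Definition ec (i : 'I_n) : g := (0, 0, 0, delta_mx 0 i).

(* The 2-form on g whose only nonzero values on basis vectors are
   omega (e i) (ec i) = 1 = - omega (ec i) (e i). *)
Definition omega (u v : g) : K :=
  \sum_i (cx i u * cy i v - cy i u * cx i v).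

(* The bilinear extension of the brackets of basis vectors; see the lemmas
   lie_* below. *)
Definition osc_lie (u v : g) : g :=
  (0, omega u v,
   \row_i (- lambda i * (cm1 u * cy i v - cm1 v * cy i u)),
   \row_i (lambda i * (cm1 u * cx i v - cm1 v * cx i u))).

Fact cm1_linear k u v : cm1 (k *: u + v) = k * cm1 u + cm1 v.
Proof. by []. Qed.
Fact c0_linear k u v : c0 (k *: u + v) = k * c0 u + c0 v.
Proof. by []. Qed.
Fact cx_linear i k u v : cx i (k *: u + v) = k * cx i u + cx i v.
Proof. by rewrite /cx !mxE. Qed.
Fact cy_linear i k u v : cy i (k *: u + v) = k * cy i u + cy i v.
Proof. by rewrite /cy !mxE. Qed.

HB.instance Definition _ := GRing.isLinear.Build K g K^o *:%R cm1 cm1_linear.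
HB.instance Definition _ := GRing.isLinear.Build K g K^o *:%R c0 c0_linear.
HB.instance Definition _ i :=
  GRing.isLinear.Build K g K^o *:%R (cx i) (cx_linear i).
HB.instance Definition _ i :=
  GRing.isLinear.Build K g K^o *:%R (cy i) (cy_linear i).

Fact oscP (u v : g) :
  cm1 u = cm1 v -> c0 u = c0 v -> (forall i, cx i u = cx i v) ->
  (forall i, cy i u = cy i v) -> u = v.
Proof.
case: u v => [[[a b] x] y] [[[a' b'] x'] y'] /=.
rewrite /cm1 /c0 /= => -> -> hx hy.
by congr (_, _, _, _); apply/rowP=> i; [apply: hx | apply: hy].
Qed.

Fact cm1_lie u v : cm1 (osc_lie u v) = 0. Proof. by []. Qed.
Fact c0_lie u v : c0 (osc_lie u v) = omega u v. Proof. by []. Qed.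
Fact cx_lie i u v :
  cx i (osc_lie u v) = - lambda i * (cm1 u * cy i v - cm1 v * cy i u).
Proof. by rewrite /cx mxE. Qed.
Fact cy_lie i u v :
  cy i (osc_lie u v) = lambda i * (cm1 u * cx i v - cm1 v * cx i u).
Proof. by rewrite /cy mxE. Qed.

Let lieE := (cm1_lie, c0_lie, cx_lie, cy_lie).
Let linE := (cm1_linear, c0_linear, cx_linear, cy_linear).
Fact cm1D u v : cm1 (u + v) = cm1 u + cm1 v. Proof. by []. Qed.
Fact c0D u v : c0 (u + v) = c0 u + c0 v. Proof. by []. Qed.
Fact cxD i u v : cx i (u + v) = cx i u + cx i v. Proof. by rewrite /cx mxE. Qed.
Fact cyD i u v : cy i (u + v) = cy i u + cy i v. Proof. by rewrite /cy mxE. Qed.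

Fact cm10 : cm1 0 = 0. Proof. by []. Qed.
Fact c00 : c0 0 = 0. Proof. by []. Qed.
Fact cx0 i : cx i 0 = 0. Proof. by rewrite /cx mxE. Qed.
Fact cy0 i : cy i 0 = 0. Proof. by rewrite /cy mxE. Qed.
Fact cm1Z k u : cm1 (k *: u) = k * cm1 u. Proof. by []. Qed.
Fact c0Z k u : c0 (k *: u) = k * c0 u. Proof. by []. Qed.
Fact cxZ i k u : cx i (k *: u) = k * cx i u. Proof. by rewrite /cx mxE. Qed.
Fact cyZ i k u : cy i (k *: u) = k * cy i u. Proof. by rewrite /cy mxE. Qed.
Let zeroE := (cm10, c00, cx0, cy0).
Let scaleE := (cm1Z, c0Z, cxZ, cyZ).

Fact omega_linearl k u u' v : omega (k *: u + u') v = k * omega u v + omega u' v.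
Proof.
rewrite /omega mulr_sumr -big_split; apply: eq_bigr => i _ /=.
by rewrite !linE; ring.
Qed.

Fact omegaC u v : omega u v = - omega v u.
Proof. by rewrite /omega -sumrN; apply: eq_bigr => i _; ring. Qed.

Fact osc_lie_linearl v : linear (osc_lie^~ v).
Proof.
move=> k u u'; apply: oscP => [||i|i]; rewrite !linE !lieE ?linE.
- by ring.
- exact: omega_linearl.
- by ring.
- by ring.
Qed.

Fact osc_lieC u v : osc_lie u v = -1 *: osc_lie v u + 0.
Proof.
apply: oscP => [||i|i]; rewrite linE !lieE.
- by rewrite zeroE; ring.
- by rewrite zeroE omegaC; ring.
- by rewrite zeroE; ring.
- by rewrite zeroE; ring.
Qed.

Fact osc_lie_linearr u : linear (osc_lie u).
Proof.
move=> k v v'; rewrite osc_lieC osc_lie_linearl addr0 scalerDr scalerA mulrC.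
by rewrite -scalerA -[_ *: _]addr0 -[-1 *: osc_lie v' u]addr0 -!osc_lieC addr0
  -[-1 *: osc_lie v u]addr0 -osc_lieC.
Qed.

Fact osc_liexx u : osc_lie u u = 0.
Proof.
apply: oscP => [||i|i]; rewrite lieE.
- by [].
- by rewrite /omega big1 // => i _; ring.
- by rewrite zeroE; ring.
- by rewrite zeroE; ring.
Qed.

Fact osc_lie_jacobi u v w :
  osc_lie u (osc_lie v w) + osc_lie v (osc_lie w u) + osc_lie w (osc_lie u v)
  = 0.
Proof.
apply: oscP => [||i|i]; rewrite ?(cm1D, c0D, cxD, cyD) !lieE.
- by rewrite zeroE; ring.
- rewrite zeroE /omega -!big_split /= big1 // => i _.
  by rewrite !lieE; ring.
- by rewrite zeroE; ring.
- by rewrite zeroE; ring.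
Qed.

HB.instance Definition _ := Vector_isLie.Build K g
  osc_lie_linearl osc_lie_linearr osc_liexx osc_lie_jacobi.

Definition em1_dual : dual g := linfun (cm1 : g -> K^o).
Definition e0_dual : dual g := linfun (c0 : g -> K^o).

Definition oscS : {vspace g} := (\sum_i <[e i]> + \sum_i <[ec i]>)%VS.

Definition bivectorS (r : dual g -> dual g -> K) : Prop :=
  [/\ bivector r, sharp r em1_dual = 0 & sharp r e0_dual = 0].

Fact cm1_em1 : cm1 em1 = 1. Proof. by []. Qed.
Fact cm1_e0 : cm1 e0 = 0. Proof. by []. Qed.
Fact cm1_e j : cm1 (e j) = 0. Proof. by []. Qed.
Fact cm1_ec j : cm1 (ec j) = 0. Proof. by []. Qed.
Fact c0_em1 : c0 em1 = 0. Proof. by []. Qed.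
Fact c0_e0 : c0 e0 = 1. Proof. by []. Qed.
Fact c0_e j : c0 (e j) = 0. Proof. by []. Qed.
Fact c0_ec j : c0 (ec j) = 0. Proof. by []. Qed.
Fact cx_em1 i : cx i em1 = 0. Proof. by rewrite /cx mxE. Qed.
Fact cx_e0 i : cx i e0 = 0. Proof. by rewrite /cx mxE. Qed.
Fact cx_e i j : cx i (e j) = (i == j)%:R. Proof. by rewrite /cx mxE. Qed.
Fact cx_ec i j : cx i (ec j) = 0. Proof. by rewrite /cx mxE. Qed.
Fact cy_em1 i : cy i em1 = 0. Proof. by rewrite /cy mxE. Qed.
Fact cy_e0 i : cy i e0 = 0. Proof. by rewrite /cy mxE. Qed.
Fact cy_e i j : cy i (e j) = 0. Proof. by rewrite /cy mxE. Qed.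
Fact cy_ec i j : cy i (ec j) = (i == j)%:R. Proof. by rewrite /cy mxE. Qed.

Let coordE := ((cm1_em1, cm1_e0, cm1_e, cm1_ec),
  (c0_em1, c0_e0, c0_e, c0_ec), (cx_em1, cx_e0, cx_e, cx_ec),
  (cy_em1, cy_e0, cy_e, cy_ec)).
Let oscE := (zeroE, scaleE, lieE, coordE).

Lemma omega_e_ec i j : omega (e i) (ec j) = (i == j)%:R.
Proof.
rewrite /omega (bigD1 i) //= big1 => [|k ki]; rewrite !coordE.
  by rewrite eqxx mul1r mul0r subr0 addr0.
by rewrite (negbTE ki) !mul0r subr0.
Qed.

Lemma omega_e_e i j : omega (e i) (e j) = 0.
Proof. by rewrite /omega big1 // => k _; rewrite !coordE; ring. Qed.

Lemma omega_ec_ec i j : omega (ec i) (ec j) = 0.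
Proof. by rewrite /omega big1 // => k _; rewrite !coordE; ring. Qed.

Lemma omega_em1 u : omega em1 u = 0.
Proof. by rewrite /omega big1 // => k _; rewrite !coordE; ring. Qed.

Lemma omega_e0 u : omega e0 u = 0.
Proof. by rewrite /omega big1 // => k _; rewrite !coordE; ring. Qed.

Let omE := (omega_e_ec, omega_e_e, omega_ec_ec, omega_em1, omega_e0).

Lemma lie_em1_e j : lie (em1 : g) (e j) = lambda j *: ec j.
Proof.
apply: oscP => [||i|i]; rewrite !oscE ?omE; try ring.
by case: eqP => [->|_]; rewrite /= ?mulr1n; ring.
Qed.

Lemma lie_em1_ec j : lie (em1 : g) (ec j) = - lambda j *: e j.
Proof.
apply: oscP => [||i|i]; rewrite !oscE ?omE; try ring.
by case: eqP => [->|_]; rewrite /= ?mulr1n; ring.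
Qed.

Lemma lie_e_ec i j : lie (e i : g) (ec j) = (i == j)%:R *: e0.
Proof.
by apply: oscP => [||k|k]; rewrite !oscE ?omE ?(mulr0, mulr1, mul0r, subr0).
Qed.

Lemma lie_e_e i j : lie (e i : g) (e j) = 0.
Proof. by apply: oscP => [||k|k]; rewrite !oscE ?omE; ring. Qed.

Lemma lie_ec_ec i j : lie (ec i : g) (ec j) = 0.
Proof. by apply: oscP => [||k|k]; rewrite !oscE ?omE; ring. Qed.

Lemma lie_e0 (u : g) : lie (e0 : g) u = 0.
Proof. by apply: oscP => [||k|k]; rewrite !oscE ?omE; ring. Qed.

End Oscillator.

Arguments em1 {K n lambda}.
Arguments e0 {K n lambda}.
Arguments oscS {K n} lambda.

(* The index condition i < j < k does not exclude lambda k = lambda i *+ 2. *)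
Definition generic (R : numDomainType) (n : nat) (lambda : 'I_n -> R) : Prop :=
  [/\ forall i, 0 < lambda i,
      forall i j : 'I_n, (i < j)%N -> lambda i < lambda j &
      forall i j k : 'I_n, (i < j)%N -> (j < k)%N ->
        lambda k != lambda i + lambda j].

(* Main.v *)
Require Import Defs.
From mathcomp Require Import all_boot all_order all_algebra.
From mathcomp Require Import reals.
From mathcomp Require Import ring.

(** Write D for ad e_{-1}.  Everything rests on the formula
    [u, v] = p(u) Dv - p(v) Du + omega(u, v) e_0, where p is the coordinate
    along e_{-1}: the algebra is a double extension of the abelian algebra S by
    the omega-skew map D.  The argument combines this shape, recorded in
    [is_extension], with the definiteness of w |-> omega(w, Dw) on S.

    Let w = r_#(e_{-1}^* ), which has no e_{-1} component.  Evaluating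
    ad_w [r,r] on e_{-1}^*, e_0^* and omega(Dw, .) leaves only
    2 omega(w, Dw)^2, so a solution r of the generalized equation satisfies
    omega(w, Dw) = 0 ([generalized_yang_baxter_radical]).  Since
    omega(w, Dw) = sum_i lambda_i (x_i^2 + y_i^2) with all lambda_i > 0, w is a
    multiple of e_0 ([omega_ad_definite]).  This is exactly the absence of a
    component e_{-1} /\ v with v in S, that is, the normal form
    r = alpha e_0 /\ e_{-1} + e_0 /\ u_0 + r_0 ([normal_form_exists]).  A
    solution of the classical equation solves the generalized one, so it has
    this form too.

    For r in normal form, u_0 cancels from the Schouten bracket, and
    [r, r] = 2 e_0 /\ B with B = omega_{r_0,r_0} + alpha ad_{e_{-1}} r_0 in the
    exterior square of S ([schouten_normal]); the classical equation is
    therefore B = 0.  As e_0 is central and ad_u maps S to the line of e_0 for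
    u in S, only e_{-1} acts on e_0 /\ B and the generalized equation is
    ad_{e_{-1}} B = 0 ([ad3_schouten_normal]).  Because D is omega-skew,
    ad_{e_{-1}} omega_{r_0,r_0} = 2 omega_{r_0, ad_{e_{-1}} r_0}
    ([ad2_reduced_bracket]); the coefficient 2 alpha in the first statement
    absorbs this factor 2. *)

Import Order.TTheory GRing.Theory Num.Theory.
Local Open Scope ring_scope.

Set Implicit Arguments.
Unset Strict Implicit.
Unset Printing Implicit Defensive.

(** * Bivectors on a Lie algebra *)

Section LieBivectors.
Variables (K : fieldType) (g : lieAlgType K).
Implicit Types (r : dual g -> dual g -> K) (a b c : dual g) (u v w : g).

Lemma dualD a u v : a (u + v) = a u + a v :> K.
Proof. by rewrite linearD. Qed.

Lemma dualN a u : a (- u) = - a u :> K.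
Proof. by rewrite linearN. Qed.

Lemma dualZ a (k : K) u : a (k *: u) = k * a u :> K.
Proof. by rewrite linearZ. Qed.

Lemma dual0 a : a 0 = 0 :> K.
Proof. by rewrite linear0. Qed.

Lemma dual_linearl (k : K) a b u : (k *: a + b) u = k * a u + b u :> K.
Proof. by rewrite add_lfunE scale_lfunE. Qed.

Lemma dual_sep u v : (forall b, b u = b v :> K) -> u = v.
Proof.
move=> uv; rewrite (coord_vbasis (memvf u)) (coord_vbasis (memvf v)).
apply: eq_bigr => i _; congr (_ *: _).
by have := uv (coord_form i); rewrite !lfunE.
Qed.

Lemma lie0r u : lie u 0 = 0.
Proof.
by have := lie_linearr u (-1) 0 0; rewrite scaler0 addr0 scaleN1r addNr.
Qed.

Lemma lie0l u : lie 0 u = 0.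
Proof.
by have := lie_linearl u (-1) 0 0; rewrite scaler0 addr0 scaleN1r addNr.
Qed.

Lemma lieDr u v w : lie u (v + w) = lie u v + lie u w.
Proof. by have := lie_linearr u 1 v w; rewrite !scale1r. Qed.

Lemma lieZr u k v : lie u (k *: v) = k *: lie u v.
Proof. by have := lie_linearr u k v 0; rewrite lie0r !addr0. Qed.

Lemma dual_lie_linearr a u k v w :
  a (lie u (k *: v + w)) = k * a (lie u v) + a (lie u w) :> K.
Proof. by rewrite lie_linearr dualD dualZ. Qed.

Lemma bivectorC r a b : bivector r -> r a b = - r b a.
Proof. by case. Qed.

Lemma bivectorxx r a : (2 : K) != 0 -> bivector r -> r a a = 0.
Proof.
move=> two_neq0 [_ /(_ a a)/eqP]; rewrite -addr_eq0 -mulr2n -mulr_natl mulf_eq0.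
by rewrite (negbTE two_neq0) => /eqP.
Qed.

Lemma bivector_linearl r b (k : K) a a' :
  bivector r -> r (k *: a + a') b = k * r a b + r a' b.
Proof. by move=> [[hl _] _]; exact: hl. Qed.

Lemma bivector_linearr r a (k : K) b b' :
  bivector r -> r a (k *: b + b') = k * r a b + r a b'.
Proof. by move=> [[_ hr] _]; exact: hr. Qed.

Lemma sharp_pairing r a b : bivector r -> b (sharp r a) = r a b :> K.
Proof. by move=> [[_ hr] _]; apply: sharpP => c; exact: hr. Qed.

Lemma sharp_pairingC r a b : bivector r -> b (sharp r a) = - a (sharp r b) :> K.
Proof. by move=> hr; rewrite !sharp_pairing // bivectorC. Qed.

Lemma sharp_linear r k a b :
  bivector r -> sharp r (k *: a + b) = k *: sharp r a + sharp r b.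
Proof.
move=> hr; apply: dual_sep => c.
by rewrite dualD dualZ !sharp_pairing // bivector_linearl.
Qed.

Lemma sharp0 r : bivector r -> sharp r 0 = 0.
Proof.
move=> hr; apply: dual_sep => c.
by rewrite sharp_pairingC // !dual0 zero_lfunE oppr0.
Qed.

Lemma schouten0l r b c : bivector r -> schouten r 0 b c = 0.
Proof.
move=> hr; rewrite /schouten sharp0 // lie0l lie0r zero_lfunE !dual0.
by rewrite !mulr0 !addr0.
Qed.

Lemma schouten_cycle r a b c : schouten r a b c = schouten r b c a.
Proof. by rewrite /schouten -addrA addrC. Qed.

Lemma coad_linear u k a b : coad u (k *: a + b) = k *: coad u a + coad u b.
Proof.
by apply/lfunP => x; rewrite !(coadE, add_lfunE, scale_lfunE).
Qed.

Lemma bivectorDZ (k : K) r1 r2 : bivector r1 -> bivector r2 ->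
  bivector (fun a b => k * r1 a b + r2 a b).
Proof.
move=> h1 h2; split; first split=> [c l a b|c l a b].
- rewrite /= (bivector_linearl _ _ _ _ h1) (bivector_linearl _ _ _ _ h2).
  by ring.
- rewrite /= (bivector_linearr _ _ _ _ h1) (bivector_linearr _ _ _ _ h2).
  by ring.
by move=> a b; rewrite (bivectorC a b h1) (bivectorC a b h2); ring.
Qed.

Lemma bivector_wedge v w : bivector (wedge v w).
Proof.
split; first split=> [c l a b|c l a b].
- by rewrite /wedge /= !dual_linearl; ring.
- by rewrite /wedge /= !dual_linearl; ring.
by move=> a b; rewrite /wedge; ring.
Qed.

Lemma bivector_ad2 u r : bivector r -> bivector (ad2 u r).
Proof.
move=> hr; split; first split=> [c l a b|c l a b].
- by rewrite /ad2 /= coad_linear !(bivector_linearl _ _ _ _ hr); ring.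
- by rewrite /ad2 /= coad_linear !(bivector_linearr _ _ _ _ hr); ring.
move=> a b; rewrite /ad2 (bivectorC (coad u a) b hr).
by rewrite (bivectorC a (coad u b) hr); ring.
Qed.

(** The action on bivectors, read on the maps r_#: since b o ad_u pairs with
    r_#(a) as b pairs with [u, r_#(a)], only the second slot contributes a
    bracket. *)
Lemma sharp_ad2 u r a : bivector r ->
  sharp (ad2 u r) a = sharp r (coad u a) + lie u (sharp r a).
Proof.
move=> hr; apply: dual_sep => c.
by rewrite dualD -coadE !sharp_pairing //; apply: bivector_ad2.
Qed.

End LieBivectors.

(** * Double extensions of an abelian Lie algebra *)

(** With S the common kernel of [p] and [q], the algebra is the direct sum of
    the line of [h], the central line of [z] and S, on which [lie h] acts as an
    [om]-skew derivation.  The functionals [p] and [q] are the coordinates along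
    [h] and [z], and [om] is a two-form on S extended by zero. *)
Record is_extension (K : fieldType) (g : lieAlgType K) (h z : g) (p q : dual g)
    (om : g -> g -> K) : Prop := IsExtension {
  ext_lie : forall u v,
    lie u v = (p u : K) *: lie h v - (p v : K) *: lie h u + om u v *: z;
  ext_central : forall u, lie u z = 0;
  ext_p_ad : forall u, p (lie h u) = 0;
  ext_q_ad : forall u, q (lie h u) = 0;
  ext_p_h : p h = 1;
  ext_p_z : p z = 0;
  ext_q_h : q h = 0;
  ext_q_z : q z = 1;
  ext_omDl : forall u u' v, om (u + u') v = om u v + om u' v;
  ext_omZl : forall k u v, om (k *: u) v = k * om u v;
  ext_omC : forall u v, om u v = - om v u;
  ext_om_diag : forall u, om u u = 0;
  ext_om_h : forall u, om h u = 0;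
  ext_om_z : forall u, om z u = 0;
  ext_om_ad : forall u v, om (lie h u) v = - om u (lie h v)
}.

Section Extension.
Variables (K : fieldType) (g : lieAlgType K) (h z : g) (p q : dual g).
Variable om : g -> g -> K.
Hypothesis two_neq0 : (2 : K) != 0.
Hypothesis ext : is_extension h z p q om.
Local Notation D := (lie h).
Implicit Types (r : dual g -> dual g -> K) (a b c : dual g) (u v w : g).

Let omDl := ext_omDl ext.
Let omZl := ext_omZl ext.
Let omC := ext_omC ext.
Let omh := ext_om_h ext.
Let omz := ext_om_z ext.

Let omDr u v v' : om u (v + v') = om u v + om u v'.
Proof. by rewrite omC omDl opprD -!(omC u). Qed.

Let omZr u k v : om u (k *: v) = k * om u v.
Proof. by rewrite omC omZl -mulrN -omC. Qed.

Let omhr u : om u h = 0.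
Proof. by rewrite omC omh oppr0. Qed.

Let omzr u : om u z = 0.
Proof. by rewrite omC omz oppr0. Qed.

Let om0r u : om u 0 = 0.
Proof. by rewrite -(scale0r z) omZr mul0r. Qed.

Let adh : D h = 0.
Proof. exact: liexx. Qed.

Lemma dual_lieE a u v :
  a (lie u v) = p u * a (D v) - p v * a (D u) + om u v * a z :> K.
Proof. by rewrite (ext_lie ext) !(dualD, dualN, dualZ). Qed.

Lemma coad_z u a : coad u a z = 0.
Proof. by rewrite coadE (ext_central ext) dual0. Qed.

Lemma coad_p u : coad u p = 0.
Proof.
apply/lfunP => x; rewrite coadE zero_lfunE dual_lieE.
by rewrite !(ext_p_ad ext) (ext_p_z ext); ring.
Qed.

Lemma coad_q u x : coad u q x = om u x.
Proof. by rewrite coadE dual_lieE !(ext_q_ad ext) (ext_q_z ext); ring. Qed.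

Lemma coad_h_q : coad h q = 0.
Proof. by apply/lfunP => x; rewrite coad_q omh zero_lfunE. Qed.

(** The coadjoint action of [u] is that of its [h] component up to a multiple
    of [p], which horizontal bivectors annihilate, and a term seen only by
    forms [a] that do not vanish on [z]. *)
Lemma coad_decomp u a :
  coad u a = (p u : K) *: coad h a
    + ((- a (D u) : K) *: p + (a z : K) *: coad u q).
Proof.
apply/lfunP => x; rewrite [LHS]coadE dual_lieE !dual_linearl coadE.
by rewrite scale_lfunE coad_q /GRing.scale /=; ring.
Qed.

Definition horizontal r : Prop :=
  [/\ bivector r, sharp r p = 0 & sharp r q = 0].

(** With w = r_#(p), the equation ad_w [r,r] = 0 is evaluated on [p], [q] and
    the form om(Dw, .).  The functionals [p] and om(Dw, .) are killed by
    [coad w], while [coad w q] is om(w, .), so a single value of [r,r] remains;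
    it equals 2 om(w, Dw)^2. *)
Lemma generalized_yang_baxter_radical r : bivector r ->
  generalized_yang_baxter r ->
  om (sharp r p) (D (sharp r p)) = 0.
Proof.
move=> hr /(_ (sharp r p) p q); set w := sharp r p => H.
have pw : p w = 0.
  by rewrite /w sharp_pairing //; exact: bivectorxx two_neq0 hr.
(* By [coad_q], this is the form om(Dw, .). *)
have := H (coad (D w) q); set c := coad (D w) q; rewrite /ad3 coad_p.
have cE x : c x = om (D w) x by exact: coad_q.
have -> : coad w c = 0.
  apply/lfunP => x; rewrite coadE zero_lfunE dual_lieE pw coad_z.
  by rewrite !cE (ext_om_diag ext); ring.
rewrite schouten0l // -(schouten_cycle r 0 p q) schouten0l // add0r addr0.
rewrite /schouten -/w (dual_lieE p) (dual_lieE (coad w q)) (dual_lieE c).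
rewrite !(ext_p_ad ext) (ext_p_z ext) !coad_z pw !(sharp_pairingC _ p) // -/w.
rewrite !cE !coad_q !(ext_om_diag ext) (ext_om_ad ext) => E.
have /eqP : 2 * om w (D w) ^+ 2 = 0 by rewrite -E; ring.
by rewrite mulf_eq0 (negbTE two_neq0) expf_eq0 /= => /eqP.
Qed.

Lemma classical_generalized r :
  classical_yang_baxter r -> generalized_yang_baxter r.
Proof. by move=> H u a b c; rewrite /ad3 !H; ring. Qed.

(** In the decomposition of g into the lines of h and z and S, the hypothesis on
    r_#(p) says that r has no component in the wedge of h with S, and fixes the
    coefficient of z /\ h; u0 is what remains of r_#(q). *)
Lemma normal_form_exists r k : bivector r -> sharp r p = k *: z ->
  exists (u0 : g) r0,
    [/\ p u0 = 0, q u0 = 0, horizontal r0 &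
        forall a b, r a b = - k * wedge z h a b + wedge z u0 a b + r0 a b].
Proof.
move=> hr rp.
pose u0 : g := sharp r q + k *: h.
pose r0 a b : K := -1 * wedge z u0 a b + (k * wedge z h a b + r a b).
have bv0 : bivector r0.
  apply: bivectorDZ (bivector_wedge _ _) _.
  exact: bivectorDZ (bivector_wedge _ _) hr.
have pu0 : p u0 = 0.
  rewrite dualD dualZ (ext_p_h ext) sharp_pairingC // rp dualZ (ext_q_z ext).
  by ring.
have qu0 : q u0 = 0.
  rewrite dualD dualZ (ext_q_h ext) sharp_pairing // (bivectorxx _ two_neq0 hr).
  by ring.
exists u0, r0; split=> //; last by move=> a b; rewrite /r0; ring.
split=> //; apply: dual_sep => b; rewrite sharp_pairing // dual0 /r0 /wedge.
  rewrite -(sharp_pairing p b hr) rp dualZ pu0 (ext_p_h ext) (ext_p_z ext).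
  by ring.
rewrite -(sharp_pairing q b hr) qu0 dualD dualZ (ext_q_h ext) (ext_q_z ext).
by ring.
Qed.

Section NormalForm.
Variables (alpha : K) (u0 : g) (r0 r : dual g -> dual g -> K).
Hypotheses (hr : bivector r) (hr0 : horizontal r0).
Hypothesis p_u0 : p u0 = 0.
Hypothesis rE : forall a b,
  r a b = alpha * wedge z h a b + wedge z u0 a b + r0 a b.

(** The bivector B on S such that [r,r] = 2 z /\ B. *)
Definition reduced_bracket b c : K :=
  form2 om r0 r0 b c + alpha * ad2 h r0 b c.

Let bv0 : bivector r0. Proof. by case: hr0. Qed.

Let p_sharp a : p (sharp r0 a) = 0.
Proof.
by rewrite sharp_pairingC //; case: hr0 => _ -> _; rewrite dual0 oppr0.
Qed.

Lemma sharp_normal a :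
  sharp r a = (alpha * a z) *: h + (- (alpha * a h + a u0)) *: z
              + ((a z : K) *: u0 + sharp r0 a).
Proof.
apply: dual_sep => b; rewrite sharp_pairing // rE !(dualD, dualZ).
by rewrite sharp_pairing // /wedge; ring.
Qed.

Lemma p_sharp_normal a : p (sharp r a) = alpha * a z :> K.
Proof.
rewrite sharp_normal !(dualD, dualZ) p_sharp p_u0 (ext_p_h ext) (ext_p_z ext).
by ring.
Qed.

Lemma om_sharp_normal a b :
  om (sharp r a) (sharp r b) =
    a z * om u0 (sharp r0 b) - b z * om u0 (sharp r0 a)
    + om (sharp r0 a) (sharp r0 b).
Proof.
rewrite !sharp_normal !(omDl, omZl) omh omz !(omDr, omZr) !omhr !omzr.
by rewrite (ext_om_diag ext) (omC (sharp r0 a) u0); ring.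
Qed.

Lemma ad_sharp_normal a b :
  b (D (sharp r a)) = a z * b (D u0) + b (D (sharp r0 a)) :> K.
Proof.
rewrite sharp_normal !(lieDr, lieZr) adh (ext_central ext) !(dualD, dualZ).
by rewrite dual0; ring.
Qed.

Lemma reduced_bracketE a b :
  reduced_bracket a b = om (sharp r0 a) (sharp r0 b)
    + alpha * (b (D (sharp r0 a)) - a (D (sharp r0 b))).
Proof.
rewrite /reduced_bracket /form2 /ad2 -!coadE !sharp_pairing //.
by rewrite (bivectorC (coad h a)) //; field.
Qed.

Lemma reduced_bracketC a b : reduced_bracket a b = - reduced_bracket b a.
Proof. by rewrite !reduced_bracketE omC; ring. Qed.

Lemma reduced_bracket_linearr a k b b' :
  reduced_bracket a (k *: b + b')
  = k * reduced_bracket a b + reduced_bracket a b'.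
Proof.
rewrite !reduced_bracketE sharp_linear // omDr omZr dual_linearl.
by rewrite dual_lie_linearr; ring.
Qed.

Lemma reduced_bracket0 a : reduced_bracket a 0 = 0.
Proof.
by rewrite reduced_bracketE sharp0 // zero_lfunE lie0r dual0 om0r; ring.
Qed.

Lemma reduced_bracket_p a : reduced_bracket a p = 0.
Proof.
rewrite reduced_bracketE; case: hr0 => _ -> _.
by rewrite (ext_p_ad ext) om0r lie0r dual0; ring.
Qed.

Lemma reduced_bracket_q a : reduced_bracket a q = 0.
Proof.
rewrite reduced_bracketE; case: hr0 => _ _ ->.
by rewrite (ext_q_ad ext) om0r lie0r dual0; ring.
Qed.

(** The terms in u0 come as a z * b z * om u0 (r0_# c) with opposite signs, once
    from each of two of the three summands, and as a z * b z * c (D u0), which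
    cancels within a single summand; what is left is linear in the values at
    z. *)
Lemma schouten_normal a b c :
  schouten r a b c = 2 * (a z * reduced_bracket b c
    + b z * reduced_bracket c a + c z * reduced_bracket a b).
Proof.
rewrite /schouten (dual_lieE a) (dual_lieE b) (dual_lieE c).
rewrite !p_sharp_normal !ad_sharp_normal !om_sharp_normal !reduced_bracketE.
by ring.
Qed.

(** Contracting [r,r] with [q] recovers the reduced bracket, because [q] is 1 on
    [z] and in the kernel of the reduced bracket. *)
Lemma classical_normal :
  classical_yang_baxter r <-> forall a b, reduced_bracket a b = 0.
Proof.
split=> H a b => [|c]; last by rewrite schouten_normal !H; ring.
have := H q a b; rewrite schouten_normal (ext_q_z ext).
rewrite (reduced_bracketC q) !reduced_bracket_q oppr0 !mulr0 !addr0 mul1r.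
by move/eqP; rewrite mulf_eq0 (negbTE two_neq0) => /eqP.
Qed.

Lemma coad_reduced_bracket u a b :
  reduced_bracket a (coad u b) = p u * reduced_bracket a (coad h b)
    + b z * reduced_bracket a (coad u q).
Proof.
rewrite [coad u b]coad_decomp !reduced_bracket_linearr reduced_bracket_p.
by rewrite -[b z *: _]addr0 reduced_bracket_linearr reduced_bracket0; ring.
Qed.

(** The extra terms b z * B(a, om(u, .)) from [coad_reduced_bracket] carry
    products a z * b z, symmetric where B is skew, so they cancel in the cyclic
    sum. *)
Lemma ad3_schouten_normal u a b c :
  ad3 u (schouten r) a b c = 2 * p u * (a z * ad2 h reduced_bracket b c
    + b z * ad2 h reduced_bracket c a + c z * ad2 h reduced_bracket a b).
Proof.
rewrite /ad3 !schouten_normal !coad_z /ad2.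
have E v x y : reduced_bracket (coad v x) y = - reduced_bracket y (coad v x).
  exact: reduced_bracketC.
rewrite !E !(coad_reduced_bracket u _ a) !(coad_reduced_bracket u _ b).
rewrite !(coad_reduced_bracket u _ c).
by ring.
Qed.

(** Leibniz rule for om_{r0,r0}: passing from r0_# composed with the
    coadjoint action to (ad_h r0)_# costs the terms om(D., .) + om(., D.), which
    vanish. *)
Lemma ad2_reduced_bracket a b :
  ad2 h reduced_bracket a b =
    2 * form2 om r0 (ad2 h r0) a b + alpha * ad2 h (ad2 h r0) a b.
Proof.
rewrite [in RHS]/form2 !sharp_ad2 // !omDr !omDl (ext_om_ad ext).
rewrite [LHS]/ad2 /reduced_bracket /form2 [ad2 h (ad2 h r0)]/ad2.
by field.
Qed.

Lemma generalized_normal :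
  generalized_yang_baxter r <-> forall a b, ad2 h reduced_bracket a b = 0.
Proof.
split=> H => [a b|u a b c]; last by rewrite ad3_schouten_normal !H; ring.
have := H h q a b.
rewrite ad3_schouten_normal (ext_p_h ext) (ext_q_z ext).
have E c : ad2 h reduced_bracket c q = 0.
  by rewrite /ad2 reduced_bracket_q coad_h_q reduced_bracket0 addr0.
have F c : ad2 h reduced_bracket q c = 0.
  rewrite -[RHS]oppr0 -(E c) /ad2 reduced_bracketC.
  by rewrite (reduced_bracketC q); ring.
rewrite E F mul1r !mulr0 !addr0 mulr1.
by move/eqP; rewrite mulf_eq0 (negbTE two_neq0) => /eqP.
Qed.

End NormalForm.
(** The second hypothesis is the definiteness that rules out components of r in
    the wedge of h with S. *)
Lemma yang_baxter_extension (S : {vspace g}) r :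
  (forall u, (u \in S) = (p u == 0) && (q u == 0)) ->
  (forall w, p w = 0 -> om w (D w) = 0 -> w = (q w : K) *: z) ->
  bivector r ->
  (generalized_yang_baxter r <->
     exists u0 r0 alpha,
       [/\ u0 \in S, horizontal r0,
           forall a b, r a b = 2 * alpha * wedge z h a b
                               + wedge z u0 a b + r0 a b &
           forall a b, form2 om r0 (ad2 h r0) a b
                       + alpha * ad2 h (ad2 h r0) a b = 0])
  /\
  (classical_yang_baxter r <->
     exists u0 r0 alpha,
       [/\ u0 \in S, horizontal r0,
           forall a b, r a b = alpha * wedge z h a b
                               + wedge z u0 a b + r0 a b &
           forall a b, form2 om r0 r0 a b + alpha * ad2 h r0 a b = 0]).
Proof.
move=> memS nondeg hr.
have decomp : generalized_yang_baxter r -> exists u0 r0 alpha,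
    [/\ u0 \in S, horizontal r0 &
     forall a b, r a b = alpha * wedge z h a b + wedge z u0 a b + r0 a b].
  move/(generalized_yang_baxter_radical hr)/nondeg => rp.
  have pr : p (sharp r p) = 0 by rewrite sharp_pairing // bivectorxx.
  have [u0 [r0 [pu0 qu0 hr0 rE]]] := normal_form_exists hr (rp pr).
  exists u0, r0; eexists.
  by split; [rewrite memS pu0 qu0 !eqxx | exact: hr0 | exact: rE].
have Sp u : u \in S -> p u = 0 by rewrite memS => /andP[/eqP].
split; split.
- move=> H; have [u0 [r0 [k [Su hr0 rE]]]] := decomp H.
  exists u0, r0, (2^-1 * k); split=> // a b; first by rewrite mulVKf.
  have := (generalized_normal hr hr0 (Sp _ Su) rE).1 H a b.
  rewrite ad2_reduced_bracket // => E.
  by rewrite -[RHS](mulr0 2^-1) -E; field.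
- move=> [u0 [r0 [k [Su hr0 rE H]]]].
  apply/(generalized_normal hr hr0 (Sp _ Su) rE) => a b.
  by rewrite ad2_reduced_bracket // -[RHS](mulr0 2) -(H a b); ring.
- move=> H; have [u0 [r0 [k [Su hr0 rE]]]] := decomp (classical_generalized H).
  exists u0, r0, k; split=> //.
  exact/(classical_normal hr hr0 (Sp _ Su) rE).
- move=> [u0 [r0 [k [Su hr0 rE H]]]].
  exact/(classical_normal hr hr0 (Sp _ Su) rE).
Qed.

End Extension.

(** * Oscillator Lie algebras *)

Section Oscillator.
Variables (K : fieldType) (n : nat) (lambda : 'I_n -> K).
Local Notation g := (oscillator lambda).
Local Notation em1 := (em1 : g).
Local Notation e0 := (e0 : g).
Local Notation D := (lie em1).
Local Notation om := (@omega K n lambda).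
Implicit Types (r : dual g -> dual g -> K) (a b c : dual g) (u v w : g).

Lemma em1_dualE u : em1_dual lambda u = cm1 u.
Proof. by rewrite lfunE. Qed.

Lemma e0_dualE u : e0_dual lambda u = c0 u.
Proof. by rewrite lfunE. Qed.

Lemma omegaDl u u' v : om (u + u') v = om u v + om u' v.
Proof. by rewrite -[u]scale1r omega_linearl mul1r scale1r. Qed.

Lemma omegaZl k u v : om (k *: u) v = k * om u v.
Proof.
by rewrite /omega mulr_sumr; apply: eq_bigr => i _; rewrite cxZ cyZ; ring.
Qed.

Lemma omega_diag u : om u u = 0.
Proof. by rewrite /omega big1 // => i _; ring. Qed.

Lemma osc_lieE u v : lie u v = cm1 u *: D v - cm1 v *: D u + om u v *: e0.
Proof.
apply: oscP => [||i|i]; rewrite -!scaleN1r.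
- by rewrite !(cm1D, cm1Z) !cm1_lie cm1_e0; ring.
- by rewrite !(c0D, c0Z) !c0_lie !omega_em1 c0_e0; ring.
- by rewrite !(cxD, cxZ) !cx_lie !cm1_em1 !cy_em1 cx_e0; ring.
- by rewrite !(cyD, cyZ) !cy_lie !cm1_em1 !cx_em1 cy_e0; ring.
Qed.

Lemma omega_adC u v : om (D u) v = - om u (D v).
Proof.
rewrite /omega -sumrN; apply: eq_bigr => i _.
by rewrite !(cx_lie, cy_lie) !cm1_em1 !cx_em1 !cy_em1; ring.
Qed.

Lemma lie_e0r u : lie u e0 = 0.
Proof.
apply: oscP => [||i|i].
- by [].
- by rewrite c0_lie omegaC omega_e0 oppr0.
- by rewrite cx_lie cy_e0 cm1_e0 cx0; ring.
- by rewrite cy_lie cx_e0 cm1_e0 cy0; ring.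
Qed.

Lemma mem_oscS u : (u \in oscS lambda) = (cm1 u == 0) && (c0 u == 0).
Proof.
apply/idP/andP => [/memv_addP[v hv [w hw ->]]|[/eqP h1 /eqP h0]].
  have ker (F : 'I_n -> g) (f : {linear g -> K^o}) z :
      (forall i, f (F i) = 0) -> z \in (\sum_i <[F i]>)%VS -> f z = 0.
    move=> fF /memv_sumP[zs zsP ->]; rewrite linear_sum big1 // => i _.
    by have /vlineP[k ->] := zsP i isT; rewrite linearZ /= fF scaler0.
  rewrite cm1D c0D (ker _ (@cm1 K n lambda : g -> K^o) v _ hv) //.
  rewrite (ker _ (@c0 K n lambda : g -> K^o) v _ hv) //.
  rewrite (ker _ (@cm1 K n lambda : g -> K^o) w _ hw) //.
  by rewrite (ker _ (@c0 K n lambda : g -> K^o) w _ hw) // addr0.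
have -> : u = \sum_i cx i u *: e lambda i + \sum_i cy i u *: ec lambda i.
  apply: oscP => [||i|i].
  - rewrite h1 cm1D !(big_morph _ (@cm1D _ _ _) (cm10 lambda)).
    by rewrite !big1 ?addr0 // => i _; rewrite cm1Z (cm1_e, cm1_ec) mulr0.
  - rewrite h0 c0D !(big_morph _ (@c0D _ _ _) (c00 lambda)).
    by rewrite !big1 ?addr0 // => i _; rewrite c0Z (c0_e, c0_ec) mulr0.
  - rewrite cxD !(big_morph _ (@cxD _ _ _ i) (cx0 lambda i)).
    rewrite [X in _ + X]big1 => [|j _]; last by rewrite cxZ cx_ec mulr0.
    rewrite (bigD1 i) //= big1 => [|j ji]; rewrite cxZ cx_e.
      by rewrite eqxx mulr1 !addr0.
    by rewrite eq_sym (negbTE ji) mulr0.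
  - rewrite cyD !(big_morph _ (@cyD _ _ _ i) (cy0 lambda i)).
    rewrite [X in X + _]big1 => [|j _]; last by rewrite cyZ cy_e mulr0.
    rewrite (bigD1 i) //= big1 => [|j ji]; rewrite cyZ cy_ec.
      by rewrite eqxx mulr1 addr0 add0r.
    by rewrite eq_sym (negbTE ji) mulr0.
by apply: memv_add; apply: memv_suml => i _; apply: memvZ;
  apply/(subvP (sumv_sup i isT (subvv _))); apply: memv_line.
Qed.

Lemma osc_extension :
  is_extension em1 e0 (em1_dual lambda) (e0_dual lambda) om.
Proof.
split=> *; rewrite ?em1_dualE ?e0_dualE.
- exact: osc_lieE.
- exact: lie_e0r.
- by [].
- by rewrite c0_lie omega_em1.
- by [].
- by [].
- by [].
- by [].
- exact: omegaDl.
- exact: omegaZl.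
- exact: omegaC.
- exact: omega_diag.
- exact: omega_em1.
- exact: omega_e0.
- exact: omega_adC.
Qed.

Lemma omega_ad_diag u :
  om u (D u) = \sum_i lambda i * (cx i u ^+ 2 + cy i u ^+ 2).
Proof.
apply: eq_bigr => i _.
by rewrite cx_lie cy_lie !cm1_em1 !cx_em1 !cy_em1; ring.
Qed.

End Oscillator.

Lemma omega_ad_definite (R : realFieldType) (n : nat) (lambda : 'I_n -> R)
    (w : oscillator lambda) :
  (forall i, 0 < lambda i) -> cm1 w = 0 -> omega w (lie em1 w) = 0 ->
  w = c0 w *: e0.
Proof.
move=> lam_gt0 w1; rewrite omega_ad_diag => /eqP.
have sq_ge0 i : 0 <= cx i w ^+ 2 + cy i w ^+ 2.
  by rewrite addr_ge0 ?sqr_ge0.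
rewrite psumr_eq0 => [/allP hw|i _]; last by rewrite mulr_ge0 // ltW.
have xy0 i : (cx i w == 0) && (cy i w == 0).
  have /= := hw i (mem_index_enum i); rewrite mulf_eq0 gt_eqF //=.
  by rewrite paddr_eq0 ?sqr_ge0 // !expf_eq0.
apply: oscP => [||i|i].
- by rewrite cm1Z cm1_e0 mulr0.
- by rewrite c0Z c0_e0 mulr1.
- by rewrite cxZ cx_e0 mulr0; case/andP: (xy0 i) => /eqP.
- by rewrite cyZ cy_e0 mulr0; case/andP: (xy0 i) => _ /eqP.
Qed.

Theorem theorem1p2 (R : realType) (n : nat) (lambda : 'I_n -> R)
    (hn : (0 < n)%N) (hlambda : generic lambda)
    (r : dual (oscillator lambda) -> dual (oscillator lambda) -> R)
    (hr : bivector r) :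
  (generalized_yang_baxter r <->
     exists (u0 : oscillator lambda)
            (r0 : dual (oscillator lambda) -> dual (oscillator lambda) -> R)
            (alpha : R),
       [/\ u0 \in oscS lambda,
           bivectorS r0,
           forall a b, r a b = 2 * alpha * wedge e0 em1 a b
                               + wedge e0 u0 a b + r0 a b &
           forall a b, form2 (@omega R n lambda) r0 (ad2 em1 r0) a b
                       + alpha * ad2 em1 (ad2 em1 r0) a b = 0])
  /\
  (classical_yang_baxter r <->
     exists (u0 : oscillator lambda)
            (r0 : dual (oscillator lambda) -> dual (oscillator lambda) -> R)
            (alpha : R),
       [/\ u0 \in oscS lambda,
           bivectorS r0,
           forall a b, r a b = alpha * wedge e0 em1 a b
                               + wedge e0 u0 a b + r0 a b &
           forall a b, form2 (@omega R n lambda) r0 r0 a b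
                       + alpha * ad2 em1 r0 a b = 0]).
Proof.
have [lam_gt0 _ _] := hlambda.
apply: (yang_baxter_extension _ (osc_extension lambda)) => //.
- by rewrite pnatr_eq0.
- by move=> u; rewrite mem_oscS em1_dualE e0_dualE.
- move=> w; rewrite em1_dualE e0_dualE; exact: omega_ad_definite.
Qed.
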